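(* Let $\epsilon\in(0,1)$ and let the number of machines $m$ be a constant. Then there is a $(1+\epsilon)$-approximation scheme for $P_m\mid \text{share},\ e_{i,k}\ge e_0 \text{ for } i\le m_1\mid C_{\max}$ running in time $O(n+\tilde n)$; that is, an algorithm that for every instance outputs a feasible schedule with makespan at most $(1+\epsilon)C^*_{\max}$ in time $O(n+\tilde n)$.
   Context: Problem $P_m\mid \text{share},\ e_{i,k}\ge e_0 \text{ for } i\le m_1\mid C_{\max}$: there are $m$ identical parallel machines $M_1,\dots,M_m$ and $n$ primary jobs with processing times $p_1,\dots,p_n>0$, all available at time $0$. The time axis of each machine $M_i$ is partitioned into consecutive intervals $I_{i,1}=(0,t_{i,1}]$, $I_{i,2}=(t_{i,1},t_{i,2}]$, $\dots$ (given in sorted order) with sharing ratios $e_{i,1},e_{i,2},\dots\in(0,1]$: during an interval with ratio $e$ the machine processes primary jobs at rate $e$ (a fraction of capacity is reserved for routine jobs; full-capacity intervals have ratio $1$). Machine $M_i$ has $k_i$ shared intervals (so $O(k_i)$ intervals in total) and $\tilde n=\sum_{i=1}^m k_i$. Integers $1\le m_1\le m-1$ and a constant $e_0\in(0,1]$ are given such that $e_{i,k}\ge e_0$ for every interval of machines $M_1,\dots,M_{m_1}$; ratios on the other machines are arbitrary in $(0,1]$. Each job is processed on exactly one machine without interruption, a machine processes at most one primary job at a time, and a job completes when the processing received (integral of the rate) equals its processing time. The objective is to minimize the makespan $C_{\max}=\max_j C_j$; $C^*_{\max}$ denotes the optimal makespan. The parameters $m,m_1,e_0,\epsilon$ are treated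 as constants in the $O$-notation. *)

(* Defs.v *)
From mathcomp Require Import all_boot all_order all_algebra.
From mathcomp Require Import all_classical all_reals all_analysis.

Set Implicit Arguments.
Unset Strict Implicit.
Unset Printing Implicit Defensive.

Import Order.TTheory GRing.Theory Num.Theory.

Local Open Scope classical_set_scope.
Local Open Scope ring_scope.

(** * Parallel machines with processing sharing *)

(** [ends] lists the finite right endpoints [t_1 < ... < t_b] of the intervals
    [(0, t_1], (t_1, t_2], ..., (t_b, +oo)], the last one being unbounded;
    [ratios] lists the [b + 1] sharing ratios in the same order. *)
Record machine (R : realType) := Machine { ends : seq R ; ratios : seq R }.

Record instance (R : realType) (m : nat) := Instance {
  njobs : nat ;
  ptime : 'I_njobs -> R ;
  mach : 'I_m -> machine R }.

Arguments ptime {R m} i _ : rename.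

Section Problem.
Variable R : realType.

(** Ratio of the interval containing [t > 0]: the index of that interval is the
    index of the first endpoint [u] with [t <= u]. *)
Definition rate (M : machine R) (t : R) : R :=
  nth 1 (ratios M) (find (fun u => t <= u) (ends M)).

Definition nshared (M : machine R) : nat := count (fun e => e < 1) (ratios M).

(** The last clause makes precise that a machine with [k] shared intervals has
    [O(k)] intervals: it holds as soon as no two full-capacity intervals are
    adjacent. *)
Definition valid_machine (M : machine R) : Prop :=
  [/\ size (ratios M) = (size (ends M)).+1,
      path <%R 0 (ends M),
      forall e, e \in ratios M -> 0 < e <= 1
    & (size (ratios M) <= (nshared M).*2.+1)%N].

Variable m : nat.

(** Machines [M_1, ..., M_m1] are those of index [i < m1]. *)
Definition valid_instance (m1 : nat) (e0 : R) (I : instance R m) : Prop :=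
  [/\ (0 < njobs I)%N,
      forall j, 0 < ptime I j,
      forall i, valid_machine (mach I i)
    & forall i : 'I_m, (i < m1)%N ->
        forall e, e \in ratios (mach I i) -> e0 <= e].

Definition total_shared (I : instance R m) : nat :=
  \sum_(i < m) nshared (mach I i).

Record schedule (n : nat) := Schedule {
  assigned : 'I_n -> 'I_m ;
  start : 'I_n -> R ;
  completion : 'I_n -> R }.

Definition feasible (I : instance R m) : set (schedule (njobs I)) :=
  [set S | (forall j, 0 <= start S j <= completion S j) /\
           (forall j,
              (\int[lebesgue_measure]_(t in `]start S j, completion S j]%classic)
                (rate (mach I (assigned S j)) t)%:E = (ptime I j)%:E)%E) /\
           (forall j k, j != k -> assigned S j = assigned S k ->
              completion S j <= start S k \/ completion S k <= start S j)].

Arguments feasible I _ : clear implicits.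

Definition makespan (n : nat) (S : schedule n) : R :=
  \big[Num.max/0]_(j < n) completion S j.

Definition opt_makespan (I : instance R m) : R :=
  inf [set makespan S | S in feasible I].

End Problem.

Arguments feasible {R m} I _.

(** * Real random-access machine

    Unit-cost model, given by structured programs over index (natural number)
    and real registers and arrays.  A program is a finite text independent of
    the input; its real literals are rational.  Indices support only addition
    and truncated subtraction, and there is no conversion (in particular no
    rounding) from reals to indices. *)

Inductive iexp :=
| IConst of nat
| IReg of nat
| IGet of nat & iexp
| IAdd of iexp & iexp
| ISub of iexp & iexp.

Inductive rexp :=
| RConst of rat
| RReg of nat
| RGet of nat & iexp
| RAdd of rexp & rexp
| RSub of rexp & rexp
| RMul of rexp & rexp
| RDiv of rexp & rexp.

Inductive bexp :=
| BLeI of iexp & iexp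
| BLeR of rexp & rexp
| BNot of bexp
| BAnd of bexp & bexp.

Inductive cmd :=
| CSkip
| CISet of nat & iexp
| CRSet of nat & rexp
| CIPut of nat & iexp & iexp
| CRPut of nat & iexp & rexp
| CSeq of cmd & cmd
| CIf of bexp & cmd & cmd
| CWhile of bexp & cmd.

Section Semantics.
Variable R : realType.

(** Arrays are designated by a fixed number occurring in the program text;
    [iarr s a k] and [rarr s a k] are the [k]-th cells of array [a]. *)
Record state := State {
  ireg : nat -> nat ;
  rreg : nat -> R ;
  iarr : nat -> nat -> nat ;
  rarr : nat -> nat -> R }.

Fixpoint ieval (s : state) (e : iexp) : nat :=
  match e with
  | IConst k => k
  | IReg x => ireg s x
  | IGet a e1 => iarr s a (ieval s e1)
  | IAdd e1 e2 => (ieval s e1 + ieval s e2)%N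
  | ISub e1 e2 => (ieval s e1 - ieval s e2)%N
  end.

Fixpoint reval (s : state) (e : rexp) : R :=
  match e with
  | RConst q => ratr q
  | RReg x => rreg s x
  | RGet a e1 => rarr s a (ieval s e1)
  | RAdd e1 e2 => reval s e1 + reval s e2
  | RSub e1 e2 => reval s e1 - reval s e2
  | RMul e1 e2 => reval s e1 * reval s e2
  | RDiv e1 e2 => reval s e1 / reval s e2
  end.

Fixpoint beval (s : state) (b : bexp) : bool :=
  match b with
  | BLeI e1 e2 => (ieval s e1 <= ieval s e2)%N
  | BLeR e1 e2 => reval s e1 <= reval s e2
  | BNot b1 => ~~ beval s b1
  | BAnd b1 b2 => beval s b1 && beval s b2
  end.

Fixpoint icost (e : iexp) : nat :=
  match e with
  | IConst _ | IReg _ => 1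
  | IGet _ e1 => (icost e1).+1
  | IAdd e1 e2 | ISub e1 e2 => (icost e1 + icost e2).+1
  end.

Fixpoint rcost (e : rexp) : nat :=
  match e with
  | RConst _ | RReg _ => 1
  | RGet _ e1 => (icost e1).+1
  | RAdd e1 e2 | RSub e1 e2 | RMul e1 e2 | RDiv e1 e2 =>
      (rcost e1 + rcost e2).+1
  end.

Fixpoint bcost (b : bexp) : nat :=
  match b with
  | BLeI e1 e2 => (icost e1 + icost e2).+1
  | BLeR e1 e2 => (rcost e1 + rcost e2).+1
  | BNot b1 => (bcost b1).+1
  | BAnd b1 b2 => (bcost b1 + bcost b2).+1
  end.

Definition upd (T : Type) (f : nat -> T) (x : nat) (v : T) : nat -> T :=
  fun y => if y == x then v else f y.

Definition set_ireg (s : state) (x v : nat) : state :=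
  State (upd (ireg s) x v) (rreg s) (iarr s) (rarr s).

Definition set_rreg (s : state) (x : nat) (v : R) : state :=
  State (ireg s) (upd (rreg s) x v) (iarr s) (rarr s).

Definition set_iarr (s : state) (a k v : nat) : state :=
  State (ireg s) (rreg s)
    (upd (iarr s) a (upd (iarr s a) k v)) (rarr s).

Definition set_rarr (s : state) (a k : nat) (v : R) : state :=
  State (ireg s) (rreg s) (iarr s)
    (upd (rarr s) a (upd (rarr s a) k v)).

(** [exec c s t s']: started in [s], the program [c] halts in [s'] after [t]
    elementary operations. *)
Inductive exec : cmd -> state -> nat -> state -> Prop :=
| exec_skip s : exec CSkip s 1 s
| exec_iset x e s :
    exec (CISet x e) s (icost e).+1 (set_ireg s x (ieval s e))
| exec_rset x e s :
    exec (CRSet x e) s (rcost e).+1 (set_rreg s x (reval s e))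
| exec_iput a e1 e2 s :
    exec (CIPut a e1 e2) s (icost e1 + icost e2).+1
      (set_iarr s a (ieval s e1) (ieval s e2))
| exec_rput a e1 e2 s :
    exec (CRPut a e1 e2) s (icost e1 + rcost e2).+1
      (set_rarr s a (ieval s e1) (reval s e2))
| exec_seq c1 c2 s1 s2 s3 t1 t2 :
    exec c1 s1 t1 s2 -> exec c2 s2 t2 s3 ->
    exec (CSeq c1 c2) s1 (t1 + t2) s3
| exec_if b c1 c2 s s' t :
    exec (if beval s b then c1 else c2) s t s' ->
    exec (CIf b c1 c2) s (bcost b + t).+1 s'
| exec_while_false b c s :
    ~~ beval s b -> exec (CWhile b c) s (bcost b).+1 s
| exec_while_true b c s1 s2 s3 t1 t2 :
    beval s1 b -> exec c s1 t1 s2 -> exec (CWhile b c) s2 t2 s3 ->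
    exec (CWhile b c) s1 (bcost b + t1 + t2).+1 s3.

Variable m : nat.

(** Input.  Index register [0] holds the number of jobs and index register
    [i + 1] the number of intervals of machine [i < m]; real array [0] holds the
    processing times, and real arrays [2i + 3] and [2i + 4] hold the interval
    endpoints and the ratios of machine [i < m].  Everything else is [0]. *)
Definition input (I : instance R m) : state :=
  {| ireg := fun x =>
       if x is i.+1 then
         if insub i is Some i' then size (ratios (mach I i')) else 0%N
       else njobs I ;
     rreg := fun _ => 0 ;
     iarr := fun _ _ => 0%N ;
     rarr := fun a k =>
       match a with
       | 0 => if insub k is Some j then ptime I j else 0
       | 1 | 2 => 0
       | a'.+3 =>
           if insub a'./2 is Some i then
             nth 0 (if odd a' then ratios (mach I i) else ends (mach I i)) k
           else 0
       end |}.

(** Output.  Index array [0] holds the machines, and real arrays [1] and [2]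
    hold the starting and completion times, of the jobs. *)
Definition outputs (n : nat) (s : state) (S : schedule R m n) : Prop :=
  forall j : 'I_n, [/\ iarr s 0 j = assigned S j,
                       rarr s 1 j = start S j
                     & rarr s 2 j = completion S j].

End Semantics.

(* Main.v *)
(* Let N be of order m^2 / (e0 eps) and P the total processing time. Jobs longer
   than P / N form bundles of their own and the other jobs are grouped into
   bundles of weight at most 2 P / N, in such a way that there are at most N + 1
   bundles. The algorithm tries all the (constantly many) assignments of the
   bundles to the machines and keeps the best one. To see that one of them is
   good, take any feasible schedule of makespan C: leave the long jobs where
   they are, fill each machine but the first greedily with bundles of short
   jobs up to its load of short jobs in the given schedule, and put the
   remaining bundles on the first machine. Only that machine gets more work than
   in the given schedule, by at most 2 m P / N <= 2 m^2 C / N; since its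
   ratios are at least e0, this delays it by at most 2 m^2 C / (N e0)
   <= eps C. *)

Require Import Defs.
From mathcomp Require Import all_boot all_order all_algebra.
From mathcomp Require Import all_classical all_reals all_analysis.
From mathcomp Require Import measurable_realfun ring lra zify.

Set Implicit Arguments.
Unset Strict Implicit.
Unset Printing Implicit Defensive.

Import Order.TTheory GRing.Theory Num.Theory.

Local Open Scope ring_scope.

(** * Work available on a machine *)

Section Work.
Variable R : realType.
Implicit Types (M : machine R) (a b x e : R).

Local Notation mu := (@lebesgue_measure R).

(** Strictly increasing in time on a valid machine, so amounts of work and instants determine each
    other; schedules are analysed through it. *)
Definition work M x : R :=
  fine (\int[mu]_(t in `]0%R, x]%classic) (rate M t)%:E)%E.

Lemma rate_mem M t : valid_machine M -> rate M t \in ratios M.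
Proof.
by case=> sz _ _ _; rewrite /rate mem_nth// sz ltnS find_size.
Qed.

Lemma rate_gt0 M t : valid_machine M -> 0 < rate M t.
Proof. by move=> vM; have [_ _ /(_ _ (rate_mem t vM))/andP[]] := vM. Qed.

Lemma rate_le1 M t : valid_machine M -> rate M t <= 1.
Proof. by move=> vM; have [_ _ /(_ _ (rate_mem t vM))/andP[]] := vM. Qed.

(** Induction on the endpoints: the rate is constant up to the first one, and beyond it is that of
    the machine without its first interval. *)
Lemma measurable_rate M : measurable_fun setT (rate M).
Proof.
case: M => s r; rewrite /rate /=.
elim: s r => [|u s ih] r /=; first exact: measurable_cst.
have -> : (fun t => nth 1 r (if t <= u then 0%N else (find (>= t) s).+1)) =
    (fun t => if t <= u then nth 1 r 0 else nth 1 (behead r) (find (>= t) s)).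
  by apply/funext => t; case: ifP => //; rewrite nth_behead.
by apply: measurable_fun_ifT => //; apply: measurable_realfun.measurable_fun_ler.
Qed.

Lemma measurable_ratee M (D : set R) :
  measurable D -> measurable_fun D (fun t => (rate M t)%:E).
Proof.
move=> mD; apply: (measurable_funS measurableT) => //.
by apply/measurable_EFinP; exact: measurable_rate.
Qed.

Lemma integral_itv_cst a b e : a <= b ->
  (\int[mu]_(t in `]a, b]%classic) e%:E = (e * (b - a))%:E)%E.
Proof.
move=> ab; rewrite integral_cst//= lebesgue_measure_itv /= lte_fin.
case: ltP => [_|ba]; first by rewrite EFinM EFinB.
by have -> : b = a by [apply/eqP; rewrite eq_le ba ab]; rewrite subrr mulr0 mule0.
Qed.

Lemma integral_rate_cst M a b e : a <= b ->
  (forall t, a < t <= b -> rate M t = e) ->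
  (\int[mu]_(t in `]a, b]%classic) (rate M t)%:E = (e * (b - a))%:E)%E.
Proof.
move=> ab H; rewrite -integral_itv_cst//; apply: eq_integral => t.
by rewrite inE /= in_itv /= => /H ->.
Qed.

Lemma integral_rate_ge M a b e : valid_machine M -> a <= b -> 0 <= e ->
  (forall t, a < t <= b -> e <= rate M t) ->
  ((e * (b - a))%:E <= \int[mu]_(t in `]a, b]%classic) (rate M t)%:E)%E.
Proof.
move=> vM ab e0 H; rewrite -integral_itv_cst//.
apply: ge0_le_integral => //.
exact: measurable_ratee.
Qed.

Lemma integral_rate_le M a b e : valid_machine M -> a <= b ->
  (forall t, a < t <= b -> rate M t <= e) ->
  (\int[mu]_(t in `]a, b]%classic) (rate M t)%:E <= (e * (b - a))%:E)%E.
Proof.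
move=> vM ab H; rewrite -integral_itv_cst//.
apply: ge0_le_integral => //.
- by move=> t _; rewrite lee_fin ltW ?rate_gt0.
exact: measurable_ratee.
Qed.

Lemma integral_rateE M a b : valid_machine M -> a <= b ->
  exists x, (\int[mu]_(t in `]a, b]%classic) (rate M t)%:E = x%:E)%E.
Proof.
move=> vM ab; have := @integral_rate_le M a b 1 vM ab (fun t _ => rate_le1 t vM).
have : (0 <= \int[mu]_(t in `]a, b]%classic) (rate M t)%:E)%E.
  by apply: integral_ge0 => t _; rewrite lee_fin ltW ?rate_gt0.
by case: (integral _ _ _) => // x _ _; exists x.
Qed.

Lemma integral_work M a b : valid_machine M -> 0 <= a -> a <= b ->
  (\int[mu]_(t in `]a, b]%classic) (rate M t)%:E = (work M b - work M a)%:E)%E.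
Proof.
move=> vM a0 ab; have b0 := le_trans a0 ab.
have [wa Ea] := integral_rateE vM a0.
have [wb Eb] := integral_rateE vM b0.
have [x Ex] := integral_rateE vM ab.
rewrite /work Ea Eb Ex /=.
have := @ge0_integral_setU _ _ _ mu `]0%R, a]%classic `]a, b]%classic
  (measurable_itv _) (measurable_itv _) (fun t => (rate M t)%:E).
rewrite -itv_bndbnd_setU ?bnd_simp// Ea Eb Ex => H.
have -> : wb = wa + x.
  apply/EFin_inj; rewrite EFinD; apply: H.
  - exact: measurable_ratee.
  - by move=> t _; rewrite lee_fin ltW ?rate_gt0.
  - apply/eqP/seteqP; split => // t [] /=; rewrite !in_itv /= => /andP[_ ta].
    by rewrite ltNge ta.
by rewrite addrC addKr.
Qed.

Lemma work0 M : work M 0 = 0.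
Proof. by rewrite /work set_itv_ge ?bnd_simp ?ltxx// integral_set0. Qed.

Lemma work_le M a b : valid_machine M -> 0 <= a -> a <= b ->
  work M b - work M a <= b - a.
Proof.
move=> vM a0 ab; rewrite -lee_fin -integral_work// -[b - a]mul1r.
by apply: integral_rate_le => // t _; exact: rate_le1.
Qed.

Lemma work_ge M a b e : valid_machine M -> 0 <= a -> a <= b -> 0 <= e ->
  (forall e', e' \in ratios M -> e <= e') ->
  e * (b - a) <= work M b - work M a.
Proof.
move=> vM a0 ab e0 H; rewrite -lee_fin -integral_work//.
by apply: integral_rate_ge => // t _; exact/H/rate_mem.
Qed.

Lemma work_lt M a b : valid_machine M -> 0 <= a -> a < b -> work M a < work M b.
Proof.
move=> vM a0 ab; rewrite -subr_gt0.
(* A finite list of positive ratios has a positive lower bound. *)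
have [e e0 He] : exists2 e, 0 < e & forall e', e' \in ratios M -> e <= e'.
  have [_ _ + _] := vM; elim: (ratios M) => [|x s ih] H; first by exists 1.
  have [|e e0 He] := ih; first by move=> y ys; rewrite H// inE ys orbT.
  exists (Num.min e x).
    by rewrite lt_min e0; case/andP: (H x (mem_head _ _)).
  by move=> y; rewrite inE ge_min => /orP[/eqP->|/He->//]; rewrite lexx orbT.
by apply: lt_le_trans (work_ge vM a0 (ltW ab) (ltW e0) He); rewrite mulr_gt0 ?subr_gt0.
Qed.

Lemma work_mono M a b : valid_machine M -> 0 <= a -> 0 <= b ->
  (work M a <= work M b) = (a <= b).
Proof.
move=> vM a0 b0; case: (leP a b) => [|ba].
  by rewrite le_eqVlt => /predU1P[->|ab]; rewrite ?lexx// ltW ?work_lt.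
by apply/negbTE; rewrite -ltNge work_lt.
Qed.

Lemma work_inj M a b : valid_machine M -> 0 <= a -> 0 <= b ->
  work M a = work M b -> a = b.
Proof.
move=> vM a0 b0 E; apply/eqP; rewrite eq_le.
by rewrite -(work_mono vM a0 b0) -(work_mono vM b0 a0) E lexx.
Qed.

(** Prepending 0 makes [nth 0 (0 :: ends M) k] the left end of interval [k]. The last interval has
    no right end, hence the conditional upper bound on [x]. *)
Lemma find_interval M k x : valid_machine M -> (k <= size (ends M))%N ->
  nth 0 (0 :: ends M) k < x -> ((k < size (ends M))%N -> x <= nth 0 (ends M) k) ->
  find (fun u => x <= u) (ends M) = k.
Proof.
case=> _ sM _ _ ks kx xk.
case: findP => [/hasPn nh|i Hi /(_ 0) xi before].
  move: ks; rewrite leq_eqVlt => /predU1P[//|ks].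
  by move: (nh _ (mem_nth 0 ks)); rewrite xk.
case: (ltngtP k i) => // ki.
  by move: (before 0 _ ki); rewrite xk// (ltn_trans ki).
case: k ki ks kx xk => // k; rewrite ltnS => ik ks /= kx _.
have : nth 0 (ends M) i <= nth 0 (ends M) k.
  move: ik; rewrite leq_eqVlt => /predU1P[->//|ik].
  by apply/ltW/(sorted_ltn_nth lt_trans) => //; [exact: path_sorted sM|rewrite inE..].
by move=> h; move: (lt_le_trans kx (le_trans xi h)); rewrite ltxx.
Qed.

Lemma ends_ge0 M k : valid_machine M -> (k <= size (ends M))%N ->
  0 <= nth 0 (0 :: ends M) k.
Proof.
case=> _ sM _ _; case: k => //= k ks.
by move: sM => /(order_path_min lt_trans)/allP/(_ _ (mem_nth 0 ks))/ltW.
Qed.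

Lemma ends_lt M k : valid_machine M -> (k < size (ends M))%N ->
  nth 0 (0 :: ends M) k < nth 0 (ends M) k.
Proof. by case=> _ /(pathP 0) sM _ _ /sM. Qed.

Lemma work_piece M k x : valid_machine M -> (k <= size (ends M))%N ->
  nth 0 (0 :: ends M) k <= x -> ((k < size (ends M))%N -> x <= nth 0 (ends M) k) ->
  work M x = work M (nth 0 (0 :: ends M) k)
             + nth 0 (ratios M) k * (x - nth 0 (0 :: ends M) k).
Proof.
move=> vM ks kx xk; have b0 := ends_ge0 vM ks.
apply/eqP; rewrite addrC -subr_eq -eqe -integral_work//; apply/eqP.
apply: integral_rate_cst => // t /andP[bt tx].
rewrite /rate (find_interval vM ks)//; last by move=> h; rewrite (le_trans tx)// xk.
by apply: set_nth_default; have [->] := vM; rewrite ltnS.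
Qed.

(** The intervals occupied by the jobs are disjoint subsets of []0, C]], so their integrals add up
    to at most the integral over []0, C]]. *)
Lemma disjoint_work M (T : finType) (P : pred T) (s c p : T -> R) C :
  valid_machine M ->
  (forall j, P j -> 0 <= s j /\ s j <= c j) ->
  (forall j, P j -> c j <= C) -> 0 <= C ->
  (forall j, P j -> (\int[mu]_(t in `]s j, c j]%classic) (rate M t)%:E = (p j)%:E)%E) ->
  (forall j k, P j -> P k -> j != k -> c j <= s k \/ c k <= s j) ->
  \sum_(j | P j) p j <= work M C.
Proof.
move=> vM sc cC C0 I D.
have <- : work M C - work M 0 = work M C by rewrite work0 subr0.
rewrite -lee_fin -integral_work// -sumEFin.
rewrite -big_filter; set l := [seq j <- _ | P j].
have lP j : j \in l -> P j by rewrite mem_filter => /andP[].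
have -> : (\sum_(j <- l) (p j)%:E =
           \sum_(j <- l) \int[mu]_(t in `]s j, c j]%classic) (rate M t)%:E)%E.
  by apply: eq_big_seq => j /lP/I.
rewrite -ge0_integral_bigsetU//=.
- apply: ge0_subset_integral => //.
  + by apply: bigsetU_measurable => j _.
  + exact: measurable_ratee.
  + by move=> t _; rewrite lee_fin ltW ?rate_gt0.
  + rewrite -bigcup_seq => t [j /= jl]; rewrite /= !in_itv /= => /andP[st tc].
    have Pj := lP _ jl; have [s0 _] := sc _ Pj.
    by rewrite (le_lt_trans s0 st) (le_trans tc (cC _ Pj)).
- by rewrite filter_uniq// index_enum_uniq.
- move=> j k /= jl kl [t [/=]]; rewrite !in_itv /= => /andP[a1 a2] /andP[a3 a4].
  apply/eqP/negP => /negP jk; case: (D j k (lP _ jl) (lP _ kl) jk) => h; lra.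
- by apply: measurable_ratee; apply: bigsetU_measurable => j _.
- by move=> t _; rewrite lee_fin ltW ?rate_gt0.
Qed.

End Work.

(** * Total correctness of programs without nested loops *)

Section ProgramLogic.
Variable R : realType.
Implicit Types (s : state R) (c : cmd) (b : bexp) (Q : state R -> Prop).

Fixpoint straight c : bool :=
  match c with
  | CWhile _ _ => false
  | CSeq c1 c2 | CIf _ c1 c2 => straight c1 && straight c2
  | _ => true
  end.

(* Junk on loops: meaningful only for [straight] programs. *)
Fixpoint run c s : state R :=
  match c with
  | CSkip | CWhile _ _ => s
  | CISet x e => set_ireg s x (ieval s e)
  | CRSet x e => set_rreg s x (reval s e)
  | CIPut a e1 e2 => set_iarr s a (ieval s e1) (ieval s e2)
  | CRPut a e1 e2 => set_rarr s a (ieval s e1) (reval s e2)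
  | CSeq c1 c2 => run c2 (run c1 s)
  | CIf b c1 c2 => if beval s b then run c1 s else run c2 s
  end.

(* A loop is charged for one iteration only: [halts] multiplies by a bound [X]
   on the number of iterations, loops not being nested. *)
Fixpoint ccost c : nat :=
  match c with
  | CSkip => 1
  | CISet _ e => (icost e).+1
  | CRSet _ e => (rcost e).+1
  | CIPut _ e1 e2 => (icost e1 + icost e2).+1
  | CRPut _ e1 e2 => (icost e1 + rcost e2).+1
  | CSeq c1 c2 => ccost c1 + ccost c2
  | CIf b c1 c2 => (bcost b + (ccost c1 + ccost c2)).+1
  | CWhile b c1 => (bcost b + ccost c1).+1
  end.

Lemma exec_straight c s : straight c ->
  exists2 t, exec c s t (run c s) & (t <= ccost c)%N.
Proof.
elim: c s => [|x e|x e|a e1 e2|a e1 e2|c1 ih1 c2 ih2|b c1 ih1 c2 ih2|b c1 ih1] s //=.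
- by exists 1%N => //; exact: exec_skip.
- by eexists; [exact: exec_iset|].
- by eexists; [exact: exec_rset|].
- by eexists; [exact: exec_iput|].
- by eexists; [exact: exec_rput|].
- case/andP=> s1 s2; have [t1 e1 l1] := ih1 s s1.
  have [t2 e2 l2] := ih2 (run c1 s) s2.
  by exists (t1 + t2)%N; [exact: exec_seq e1 e2|rewrite leq_add].
- case/andP=> s1 s2; have [t1 e1 l1] := ih1 s s1.
  have [t2 e2 l2] := ih2 s s2.
  case: ifP => hb; [exists (bcost b + t1).+1|exists (bcost b + t2).+1].
  + by apply: exec_if; rewrite hb.
  + by rewrite ltnS leq_add2l (leq_trans l1)// leq_addr.
  + by apply: exec_if; rewrite hb.
  + by rewrite ltnS leq_add2l (leq_trans l2)// leq_addl.
Qed.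

(** The factor [ccost c] depends on the program text alone, so an [X] linear in the input size
    yields linear time. *)
Definition halts (X : nat) c s Q : Prop :=
  exists t s', [/\ exec c s t s', (t <= ccost c * X)%N & Q s'].

Lemma halts_conseq X c s Q Q' :
  halts X c s Q -> (forall s', Q s' -> Q' s') -> halts X c s Q'.
Proof. by case=> t [s' [? ? q]] H; exists t, s'; split=> //; exact: H. Qed.

Lemma halts_run X c s Q : (0 < X)%N -> straight c -> Q (run c s) -> halts X c s Q.
Proof.
move=> X0 /(exec_straight s)[t et lt] q; exists t, (run c s); split=> //.
by rewrite (leq_trans lt)// leq_pmulr.
Qed.

Lemma halts_seq X c1 c2 s Q :
  halts X c1 s (fun s' => halts X c2 s' Q) -> halts X (CSeq c1 c2) s Q.
Proof.
case=> t1 [s1 [e1 l1 [t2 [s2 [e2 l2 q]]]]].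
exists (t1 + t2)%N, s2; split=> //; first exact: exec_seq e1 e2.
by rewrite /= mulnDl leq_add.
Qed.

Lemma halts_while (Inv : state R -> Prop) (mu : state R -> nat) X b c s Q :
  straight c -> (mu s < X)%N -> Inv s ->
  (forall s, Inv s -> beval s b -> Inv (run c s) /\ (mu (run c s) < mu s)%N) ->
  (forall s, Inv s -> ~~ beval s b -> Q s) ->
  halts X (CWhile b c) s Q.
Proof.
move=> sc muX I0 step post.
(* The induction needs a bound in terms of [mu s], which drops at each iteration, instead of the
   fixed [X]; the [.+1] pays for the final test. *)
suff [t [s' [et lt q]]] : exists t s',
    [/\ exec (CWhile b c) s t s', (t <= (mu s).+1 * (bcost b + ccost c).+1)%N & Q s'].
  by exists t, s'; split=> //=; rewrite (leq_trans lt)// mulnC leq_mul2l muX orbT.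
have [k] := ubnP (mu s); elim: k s {muX} I0 => // k ih s I0 muk.
have [hb|hb] := boolP (beval s b); last first.
  exists (bcost b).+1, s; split; [exact: exec_while_false|nia|exact: post].
have [I1 lt1] := step s I0 hb.
have [t1 e1 l1] := exec_straight s sc.
have [|t2 [s2 [e2 l2 q]]] := ih _ I1; first by rewrite (leq_trans lt1).
exists (bcost b + t1 + t2).+1, s2; split=> //; first exact: exec_while_true e1 e2.
have : ((mu (run c s)).+1 * (bcost b + ccost c).+1 <= mu s * (bcost b + ccost c).+1)%N.
  by rewrite leq_mul2r lt1 orbT.
lia.
Qed.

End ProgramLogic.

(** * Rounding a schedule to bundles *)

Section Rounding.
Variable R : realFieldType.

(* Greedy filling: as soon as a weight overflows to [i0], every other machine
   is filled up to less than one weight. *)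
Lemma greedy_fill (T : eqType) m (i0 : 'I_m) (w : T -> R) (s : seq T)
    (c : 'I_m -> R) (eta : R) :
  uniq s -> (forall v, v \in s -> 0 <= w v <= eta) -> (forall i, 0 <= c i) ->
  exists g : T -> 'I_m,
    (forall i, i != i0 -> \sum_(v <- s | g v == i) w v <= c i) /\
    (\sum_(v <- s | g v == i0) w v = 0 \/
     forall i, i != i0 -> c i - eta <= \sum_(v <- s | g v == i) w v).
Proof.
move=> + + c0; elim: s => [|x s ih] /=.
  move=> _ _; exists (fun=> i0); split; last by left; rewrite big_nil.
  by move=> i _; rewrite big_nil.
case/andP=> xs us H.
have [|g [g1 g2]] := ih us; first by move=> v vs; apply: H; rewrite inE vs orbT.
have /andP[wx0 wxe] := H x (mem_head _ _).
have E h i : (forall v, v \in s -> h v = g v) ->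
    \sum_(v <- x :: s | h v == i) w v =
    (if h x == i then w x else 0) + \sum_(v <- s | g v == i) w v.
  move=> hg; rewrite big_cons.
  have -> : \sum_(v <- s | h v == i) w v = \sum_(v <- s | g v == i) w v.
    by rewrite !(big_mkcond (fun v => _ v == i)); apply: eq_big_seq => v /hg ->.
  by case: ifP => _; rewrite ?add0r.
pose h k v := if v == x then k else g v.
have hg k v : v \in s -> h k v = g v.
  by move=> vs; rewrite /h; case: eqP => // vx; move: xs; rewrite -vx vs.
have hx k : h k x = k by rewrite /h eqxx.
(* The new item goes to a machine other than [i0] with enough room, if there is one. *)
have [/existsP[k /andP[k0 kc]]|nok] :=
    boolP [exists k, (k != i0) && (w x + \sum_(v <- s | g v == k) w v <= c k)].
- exists (h k); split=> [i ii0|].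
    rewrite (E _ _ (hg k)) hx; case: eqP => [<-//|_]; rewrite add0r; exact: g1.
  case: g2 => [z|f]; [left|right].
    by rewrite (E _ _ (hg k)) hx (negbTE k0) add0r.
  move=> i ii0; rewrite (E _ _ (hg k)) hx.
  by case: ifP => _; rewrite ?add0r ?f// ler_wpDl// f.
(* No other machine has room, so each is within [w x <= eta] of its capacity, and the item overflows
   to [i0]. *)
- have {}nok i : i != i0 -> c i < w x + \sum_(v <- s | g v == i) w v.
    by move=> ii0; move/existsPn: nok => /(_ i); rewrite ii0 /= -ltNge.
  exists (h i0); split=> [i ii0|].
    by rewrite (E _ _ (hg i0)) hx eq_sym (negbTE ii0) add0r; exact: g1.
  right=> i ii0; rewrite (E _ _ (hg i0)) hx eq_sym (negbTE ii0) add0r.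
  by have := nok _ ii0; lra.
Qed.

(** After an overflow the other machines lack at most [eta] each. The total weight being at most the
    total capacity, [i0] exceeds its own capacity by at most [m - 1] times [eta], rounded up to [m]
    times. *)
Lemma greedy_fill_load (T : eqType) m (i0 : 'I_m) (w : T -> R) (s : seq T)
    (c : 'I_m -> R) (eta : R) :
  uniq s -> (forall v, v \in s -> 0 <= w v <= eta) -> (forall i, 0 <= c i) ->
  0 <= eta -> \sum_(v <- s) w v <= \sum_i c i ->
  exists g : T -> 'I_m,
    (forall i, i != i0 -> \sum_(v <- s | g v == i) w v <= c i) /\
    \sum_(v <- s | g v == i0) w v <= c i0 + m%:R * eta.
Proof.
move=> us ws c0 e0 tot; have [g [g1 g2]] := greedy_fill i0 us ws c0.
exists g; split=> //; case: g2 => [->|g2].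
  by rewrite addr_ge0// mulr_ge0.
have : \sum_(i | i != i0) (c i - eta) <= \sum_(i | i != i0) \sum_(v <- s | g v == i) w v.
  exact: ler_sum.
move: tot; rewrite (partition_big g xpredT)//= (bigD1 i0)//= [leRHS](bigD1 i0)//=.
rewrite sumrB.
have : \sum_(i < m | i != i0) eta <= m%:R * eta.
  rewrite mulr_natl -[m in leRHS]card_ord -sumr_const [leRHS](bigD1 i0)//=.
  by rewrite lerDr.
lra.
Qed.

(** Bundles with at most one job follow [sigma]; the others are placed greedily, the capacity of a
    machine being what [sigma] gives it of their jobs. These capacities add up exactly to the weight
    to be placed. *)
Lemma bundle_rounding (T : finType) n m (p : 'I_n -> R) (b : 'I_n -> T)
    (sigma : 'I_n -> 'I_m) (i0 : 'I_m) (eta : R) :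
  (forall j, 0 <= p j) -> 0 <= eta ->
  (forall v, \sum_(j | b j == v) p j <= eta \/
             forall j j', b j = v -> b j' = v -> j = j') ->
  exists F : {ffun T -> 'I_m},
    (forall i, i != i0 ->
       \sum_(j | F (b j) == i) p j <= \sum_(j | sigma j == i) p j) /\
    \sum_(j | F (b j) == i0) p j <= \sum_(j | sigma j == i0) p j + m%:R * eta.
Proof.
move=> p0 e0 H.
pose single v := [forall j, forall j', (b j == v) && (b j' == v) ==> (j == j')].
have singleP v j j' : single v -> b j = v -> b j' = v -> j = j'.
  by move=> /forallP/(_ j)/forallP/(_ j')/implyP h /eqP h1 /eqP h2; apply/eqP/h; rewrite h1.
pose w v := \sum_(j | b j == v) p j.
pose c i := \sum_(j | (sigma j == i) && ~~ single (b j)) p j.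
pose s := [seq v <- index_enum T | ~~ single v].
have us : uniq s by rewrite filter_uniq// index_enum_uniq.
have ws v : v \in s -> 0 <= w v <= eta.
  rewrite mem_filter => /andP[ns _]; rewrite sumr_ge0//=.
  case: (H v) => // u; case/negP: ns; apply/forallP => j; apply/forallP => j'.
  by apply/implyP => /andP[/eqP h1 /eqP h2]; rewrite (u _ _ h1 h2).
have sumw (g : T -> 'I_m) i : \sum_(v <- s | g v == i) w v =
    \sum_(j | (g (b j) == i) && ~~ single (b j)) p j.
  rewrite big_filter_cond /w.
  rewrite (partition_big b (fun v => ~~ single v && (g v == i))) /=; last first.
    by move=> j; rewrite andbC.
  apply: eq_bigr => v /andP[sv gv]; apply: eq_bigl => j.
  by case: (eqVneq (b j) v) => [->|]; rewrite ?gv ?sv ?andbF.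
have tot : \sum_(v <- s) w v <= \sum_i c i.
  rewrite le_eqVlt; apply/orP; left; apply/eqP.
  transitivity (\sum_(j | ~~ single (b j)) p j).
    (* Partitioning by a constant map only brings both sums into the form to which [sumw]
       applies. *)
    rewrite (partition_big (fun=> i0) xpredT)//= [RHS](partition_big (fun=> i0) xpredT)//=.
    by apply: eq_bigr => i _; rewrite sumw; apply: eq_bigl => j; rewrite andbC.
  rewrite (partition_big sigma xpredT)//=; apply: eq_bigr => i _.
  by apply: eq_bigl => j; rewrite andbC.
have [g [g1 g2]] := greedy_fill_load i0 us ws (fun i => sumr_ge0 _ (fun j _ => p0 j)) e0 tot.
(* Empty bundles also count as [single]; for them [i0] is an arbitrary default. *)
pose F := [ffun v => if single v then
   (if [pick j | b j == v] is Some j then sigma j else i0) else g v].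
have Fload i : \sum_(j | F (b j) == i) p j =
    \sum_(j | (sigma j == i) && single (b j)) p j + \sum_(v <- s | g v == i) w v.
  rewrite sumw (bigID (single \o b)) /=; congr (_ + _); apply: eq_bigl => j; rewrite ffunE.
    case: (boolP (single (b j))) => sj; rewrite ?andbF// !andbT.
    case: pickP => [j' /eqP bj|/(_ j)]; last by rewrite eqxx.
    by rewrite (singleP _ _ _ sj bj erefl).
  by case: (boolP (single (b j))) => sj; rewrite ?andbF.
have Sload i : \sum_(j | sigma j == i) p j =
    \sum_(j | (sigma j == i) && single (b j)) p j + c i.
  by rewrite (bigID (single \o b)).
exists F; split=> [i ii0|]; rewrite Fload Sload; last by rewrite -addrA lerD2l.
by rewrite lerD2l g1.
Qed.

End Rounding.

(** * Forming the bundles *)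

Section Psum.
Variable R : realFieldType.
Implicit Types (p : nat -> R) (a b : nat -> nat).

(** Serves twice: as the weight of a bundle and as the load of a machine, restricted to the first
    [j] jobs. *)
Definition psum p a v j : R := \sum_(i < j | a i == v) p i.

Lemma psum0 p a v : psum p a v 0 = 0.
Proof. by rewrite /psum big_ord0. Qed.

Lemma psumS p a v j :
  psum p a v j.+1 = psum p a v j + (if a j == v then p j else 0).
Proof. by rewrite /psum big_mkcond big_ord_recr /= -big_mkcond. Qed.

Lemma eq_psum p a b v j : (forall i, (i < j)%N -> a i = b i) ->
  psum p a v j = psum p b v j.
Proof. by move=> H; apply: eq_bigl => i; rewrite H. Qed.

Lemma psum_fresh p a v j : (forall i, (i < j)%N -> (a i < v)%N) -> psum p a v j = 0.
Proof. by move=> H; rewrite /psum big_pred0// => i; rewrite ltn_eqF ?H. Qed.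

Lemma psum_mono p a v j k : (forall i, 0 <= p i) -> (j <= k)%N ->
  psum p a v j <= psum p a v k.
Proof.
move=> p0 /subnK <-; elim: (k - j)%N => //= d ih.
by rewrite addSn psumS (le_trans ih)// lerDl; case: ifP.
Qed.

End Psum.

Lemma upd_eq T (f : nat -> T) x v : upd f x v x = v.
Proof. by rewrite /upd eqxx. Qed.

Lemma upd_ne T (f : nat -> T) x v y : y != x -> upd f x v y = f y.
Proof. by rewrite /upd => /negbTE ->. Qed.

Section Bundling.
Variables (R : realFieldType) (p : nat -> R) (N : nat) (P : R).
Hypothesis p_ge0 : forall i, 0 <= p i.
Hypothesis P_ge0 : 0 <= P.

(* Bundle [cur] is open and has weight [load]; the bundles [< nxt] are in use,
   and each one other than [cur] is full or a single large job. *)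
Record bundling (j : nat) (b : nat -> nat) (cur nxt : nat) (load : R) : Prop :=
  Bundling {
    cur_lt_nxt : (cur < nxt)%N ;
    bundle_lt_nxt : forall i, (i < j)%N -> (b i < nxt)%N ;
    load_cur : load = psum p b cur j ;
    load_le : N%:R * load <= P ;
    closed_bundles : (nxt%:R - 1) * P <= N%:R * (\sum_(i < j) p i - load) ;
    bundle_shape : forall v, N%:R * psum p b v j <= 2 * P \/
      forall i i', (i < j)%N -> (i' < j)%N -> b i = v -> b i' = v -> i = i' }.

Lemma bundling_start b : bundling 0 b 0 1 0.
Proof.
split=> //.
- by rewrite psum0.
- by rewrite mulr0.
- by rewrite big_ord0 !subrr mulr0 mul0r.
- by move=> v; right.
Qed.

Section Step.
Variables (j : nat) (b : nat -> nat) (cur nxt : nat) (load : R).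
Hypothesis B : bundling j b cur nxt load.

Lemma psum_upd v u : psum p (upd b j v) u j.+1 =
  psum p b u j + (if v == u then p j else 0).
Proof.
rewrite psumS upd_eq; congr (_ + _); apply: eq_psum => i ij.
by rewrite upd_ne// ltn_eqF.
Qed.

Lemma upd_lt v n : (v < n)%N -> (nxt <= n)%N ->
  forall i, (i < j.+1)%N -> (upd b j v i < n)%N.
Proof.
move=> vn nn i; rewrite ltnS leq_eqVlt => /predU1P[->|ij]; first by rewrite upd_eq.
by rewrite upd_ne ?ltn_eqF// (leq_trans (bundle_lt_nxt B ij)).
Qed.

Lemma bundle_shape_other v u : v != u ->
  N%:R * psum p (upd b j v) u j.+1 <= 2 * P \/
  forall i i', (i < j.+1)%N -> (i' < j.+1)%N ->
    upd b j v i = u -> upd b j v i' = u -> i = i'.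
Proof.
move=> vu; rewrite psum_upd (negbTE vu) addr0.
have [|h] := bundle_shape B u; [by left|right=> i i'; rewrite !ltnS].
rewrite leq_eqVlt => /predU1P[->|ij].
  by move=> _; rewrite upd_eq => E; rewrite E eqxx in vu.
rewrite leq_eqVlt => /predU1P[->|ij'].
  by move=> _; rewrite upd_eq => E; rewrite E eqxx in vu.
by rewrite !upd_ne ?ltn_eqF//; exact: h.
Qed.

Lemma bundling_add : N%:R * (load + p j) <= P ->
  bundling j.+1 (upd b j cur) cur nxt (load + p j).
Proof.
move=> le; have ps : psum p (upd b j cur) cur j.+1 = load + p j.
  by rewrite psum_upd eqxx (load_cur B).
split=> //.
- exact: cur_lt_nxt B.
- exact: upd_lt (cur_lt_nxt B) (leqnn _).
- rewrite big_ord_recr /= (le_trans (closed_bundles B))//.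
  by rewrite opprD addrACA subrr addr0.
- move=> v; have [<-|nv] := eqVneq cur v; last exact: bundle_shape_other.
  by left; rewrite ps (le_trans le)// mulr2n mulrDl mul1r lerDl.
Qed.

(** [N] times the open bundle and [N] times the new job are each at most [P], whence the bound
    [2 * P]; together they reach [P], so the bundle counts as full. *)
Lemma bundling_close : N%:R * p j <= P -> P <= N%:R * (load + p j) ->
  bundling j.+1 (upd b j cur) nxt nxt.+1 0.
Proof.
move=> le ge; have cn := cur_lt_nxt B; have lt := upd_lt cn (leqnn _).
split=> //.
- by move=> i /lt /ltnW.
- by rewrite psum_fresh.
- by rewrite mulr0.
- rewrite big_ord_recr /= -natr1 addrK subr0; have := closed_bundles B; lra.
- move=> v; have [<-|nv] := eqVneq cur v; last exact: bundle_shape_other.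
  left; rewrite psum_upd eqxx -(load_cur B) mulrDr.
  by have := load_le B; lra.
Qed.

(** A large job pays for a bundle of its own, and the open bundle stays open for later small
    jobs. *)
Lemma bundling_large : P <= N%:R * p j ->
  bundling j.+1 (upd b j nxt) cur nxt.+1 load.
Proof.
move=> ge; have cn := cur_lt_nxt B.
split=> //.
- by rewrite ltnW.
- exact: upd_lt.
- by rewrite psum_upd gtn_eqF// addr0 (load_cur B).
- exact: load_le B.
- rewrite big_ord_recr /= -natr1 addrK; have := closed_bundles B; lra.
- move=> v; have [<-|nv] := eqVneq nxt v; last exact: bundle_shape_other.
  have H i : (i < j.+1)%N -> upd b j nxt i = nxt -> i = j.
    rewrite ltnS leq_eqVlt => /predU1P[//|ij]; rewrite upd_ne ?ltn_eqF// => E.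
    by have := bundle_lt_nxt B ij; rewrite E ltnn.
  by right=> i i' hi hi' /(H _ hi) -> /(H _ hi') ->.
Qed.

End Step.

(** By [closed_bundles], the [nxt - 1] bundles other than the open one weigh at least [P / N] on
    average; the total is [P], so there are at most [N] of them. *)
Lemma bundling_count j b cur nxt load : 0 < P -> P = \sum_(i < j) p i ->
  bundling j b cur nxt load -> forall i, (i < j)%N -> (b i < N.+1)%N.
Proof.
move=> P0 EP B i ij; apply: (leq_trans (bundle_lt_nxt B ij)).
have l0 : 0 <= load by rewrite (load_cur B) sumr_ge0.
rewrite -(ler_nat R) -natr1 -lerBlDr -(ler_pM2r P0).
apply: (le_trans (closed_bundles B)); rewrite -EP ler_wpM2l//.
by rewrite gerBl.
Qed.

End Bundling.

(** * The algorithm *)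

(* The index registers of the number of jobs and of intervals are never
   written; the cells of index array 1 serve as index variables:
   0 = current job, 1 and 2 = open bundle and next bundle, or 1 = current
   interval. Index arrays 2, 3, 4: bundle of a job, machine of a bundle, best
   machine of a bundle so far. *)
Definition ivar k := IGet 1 (IConst k).
Definition iset k e := CIPut 1 (IConst k) e.
Definition incr k := iset k (IAdd (ivar k) (IConst 1)).
Definition jobs_left := BNot (BLeI (IReg 0) (ivar 0)).
Definition job_time := RGet 0 (ivar 0).

Definition sum_prog :=
  CSeq (CSeq (iset 0 (IConst 0)) (CRSet 0 (RConst 0)))
    (CWhile jobs_left
       (CSeq (CRSet 0 (RAdd (RReg 0) job_time)) (incr 0))).

(* Real registers: 0 = total processing time, 1 = weight of the open bundle. *)
Definition bundle_prog (N : nat) :=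
  let times_le e := BLeR (RMul (RConst N%:R) e) (RReg 0) in
  CSeq (CSeq (iset 0 (IConst 0)) (CSeq (iset 1 (IConst 0))
         (CSeq (iset 2 (IConst 1)) (CRSet 1 (RConst 0)))))
    (CWhile jobs_left
       (CSeq (CIf (times_le job_time)
                (CSeq (CSeq (CIPut 2 (ivar 0) (ivar 1))
                            (CRSet 1 (RAdd (RReg 1) job_time)))
                   (CIf (times_le (RReg 1)) CSkip
                      (CSeq (iset 1 (ivar 2)) (CSeq (incr 2) (CRSet 1 (RConst 0))))))
                (CSeq (CIPut 2 (ivar 0) (ivar 2)) (incr 2)))
          (incr 0))).

(* Real registers: 1 = work assigned to machine [i] so far and 4 = its
   completion time; 3 = beginning of the current interval and 2 = work
   available before it; 5 = makespan; 6 = best makespan so far. *)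
Definition machine_body (i : nat) :=
  let asg := IGet 3 (IGet 2 (ivar 0)) in
  let next_work := RAdd (RReg 1) job_time in
  let ratio := RGet i.*2.+1.+3 (ivar 1) in
  let interval_end := RGet i.*2.+3 (ivar 1) in
  let work_end := RAdd (RReg 2) (RMul ratio (RSub interval_end (RReg 3))) in
  CIf (BAnd (BLeI asg (IConst i)) (BLeI (IConst i) asg))
    (CIf (BAnd (BNot (BLeI (IReg i.+1) (IAdd (ivar 1) (IConst 1))))
               (BNot (BLeR next_work work_end)))
       (CSeq (CRSet 2 work_end) (CSeq (CRSet 3 interval_end) (incr 1)))
       (CSeq (CRPut 1 (ivar 0) (RReg 4)) (CSeq (CRSet 1 next_work)
         (CSeq (CRSet 4 (RAdd (RReg 3) (RDiv (RSub (RReg 1) (RReg 2)) ratio)))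
            (CSeq (CRPut 2 (ivar 0) (RReg 4))
               (CSeq (CIPut 0 (ivar 0) (IConst i)) (incr 0)))))))
    (incr 0).

Definition machine_prog (i : nat) :=
  CSeq (CSeq (CSeq (iset 0 (IConst 0)) (iset 1 (IConst 0)))
             (CSeq (CSeq (CRSet 1 (RConst 0)) (CRSet 2 (RConst 0)))
                   (CSeq (CRSet 3 (RConst 0)) (CRSet 4 (RConst 0)))))
    (CSeq (CWhile jobs_left (machine_body i))
       (CIf (BLeR (RReg 4) (RReg 5)) CSkip (CRSet 5 (RReg 4)))).

(** * Correctness of the summation and bundling loops *)

Section Preprocessing.
Variables (R : realType) (m : nat) (I : instance R m).
Implicit Types (s : state R).

(** Real arrays 1 and 2 are left out because the schedule is written there. *)
Definition keeps_input s :=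
  [/\ ireg s = ireg (input I), rarr s 0 = rarr (input I) 0
    & forall a, rarr s a.+3 = rarr (input I) a.+3].

Definition job_size : nat -> R := rarr (input I) 0.

Lemma input_ends (i : 'I_m) : rarr (input I) i.*2.+3 = nth 0 (ends (mach I i)).
Proof. by apply/funext => k /=; rewrite odd_double doubleK valK. Qed.

Lemma input_ratios (i : 'I_m) :
  rarr (input I) i.*2.+1.+3 = nth 0 (ratios (mach I i)).
Proof.
by apply/funext => k /=; rewrite odd_double /= uphalf_double valK.
Qed.

Lemma job_sizeE (j : 'I_(njobs I)) : job_size j = ptime I j.
Proof. by rewrite /job_size /= valK. Qed.

Lemma sum_halts X s : (njobs I < X)%N -> keeps_input s ->
  halts X sum_prog s (fun s' =>
    keeps_input s' /\ rreg s' 0 = \sum_(i < njobs I) job_size i).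
Proof.
move=> nX ks; have X0 : (0 < X)%N by exact: leq_trans nX.
apply/halts_seq/halts_run => //=.
pose Inv s := [/\ keeps_input s, (iarr s 1 0 <= njobs I)%N
  & rreg s 0 = \sum_(i < iarr s 1 0) job_size i].
apply: (@halts_while _ Inv (fun s => (njobs I - iarr s 1 0)%N)) => //=.
- by rewrite (leq_ltn_trans (leq_subr _ _)).
- by split=> //=; rewrite big_ord0 rmorph0.
- move=> {ks}s [[k1 k2 k3] le E]; rewrite k1 /= -ltnNge => lt; split; last first.
    by rewrite /upd /= addn1 ltn_sub2l.
  split=> //=; rewrite /upd /= addn1 //.
  by rewrite big_ord_recr /= E k2.
- move=> {ks}s [ks le E]; rewrite negbK; have [-> _ _] := ks => /= ge.
  have En : iarr s 1 0 = njobs I by lia.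
  by move: E; rewrite En => E; split.
Qed.

(** The loop invariant is [bundling]; the branches of the loop body are the transitions
    [bundling_large], [bundling_add] and [bundling_close]. *)
Lemma bundle_halts X N P s : (forall i, 0 <= job_size i) ->
  P = \sum_(i < njobs I) job_size i -> 0 < P ->
  (njobs I < X)%N -> keeps_input s -> rreg s 0 = P ->
  halts X (bundle_prog N) s (fun s' =>
    [/\ keeps_input s',
      forall i, (i < njobs I)%N -> (iarr s' 2 i < N.+1)%N
      & forall v, N%:R * psum job_size (iarr s' 2) v (njobs I) <= 2 * P \/
        forall i i', (i < njobs I)%N -> (i' < njobs I)%N ->
          iarr s' 2 i = v -> iarr s' 2 i' = v -> i = i']).
Proof.
move=> p0 EP P0 nX ks sP; have X0 : (0 < X)%N by exact: leq_trans nX.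
apply/halts_seq/halts_run => //=.
pose Inv s := [/\ keeps_input s, rreg s 0 = P, (iarr s 1 0 <= njobs I)%N
  & bundling job_size N P (iarr s 1 0) (iarr s 2) (iarr s 1 1) (iarr s 1 2) (rreg s 1)].
apply: (@halts_while _ Inv (fun s => (njobs I - iarr s 1 0)%N)) => //.
- by rewrite (leq_ltn_trans (leq_subr _ _)).
- by split=> //=; rewrite /upd /= rmorph0; apply: bundling_start; rewrite // ltW.
- move=> {sP ks}s [[k1 k2 k3] sP le B]; rewrite /= k1 /= -ltnNge => lt.
  rewrite /= !ratr_nat sP k2 -/job_size.
  have dec : (njobs I - (iarr s 1 0).+1 < njobs I - iarr s 1 0)%N by lia.
  have [small|large] := boolP (N%:R * job_size (iarr s 1 0) <= P); last first.
    split; last by rewrite /upd /= addn1.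
    split=> //=; rewrite /upd /= ?addn1//.
    by apply: bundling_large => //; rewrite ltW// ltNge.
  rewrite /upd /= sP.
  have [fits|full] := boolP (N%:R * (rreg s 1 + job_size (iarr s 1 0)) <= P).
    split; last by rewrite /upd /= addn1.
    split=> //=; rewrite /upd /= ?addn1//.
    by apply: bundling_add => //; exact: ltW.
  split; last by rewrite /upd /= addn1.
  split=> //=; rewrite /upd /= ?addn1// rmorph0.
  by apply: bundling_close B small _; rewrite ltW// ltNge.
- move=> {sP ks}s [ks sP le B]; rewrite negbK /=; have [-> _ _] := ks => /= ge.
  have En : iarr s 1 0 = njobs I by lia.
  rewrite En in B; split=> //; first exact: bundling_count B.
  exact: bundle_shape B.
Qed.

End Preprocessing.

(** * Scheduling program for a given assignment *)

Definition machines_prog (l : seq nat) :=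
  foldr (fun i c => CSeq (machine_prog i) c) CSkip l.

Definition schedule_prog (m : nat) :=
  CSeq (CRSet 5 (RConst 0)) (machines_prog (map val (enum 'I_m))).

(** * Inverting the work function *)

Section Interval.
Variables (R : realType) (M : machine R).
Hypothesis vM : valid_machine M.

(** An inverse of [work M] obtained by choice. It serves the specification only; the program finds
    the same times by arithmetic. *)
Definition finish (L : R) : R := get [set x | 0 <= x /\ work M x = L]%classic.

Lemma finishE x : 0 <= x -> finish (work M x) = x.
Proof.
move=> x0; have [] := @getPex _ [set y | 0 <= y /\ work M y = work M x]%classic.
  by exists x.
by move=> h /(work_inj vM h x0).
Qed.

Lemma work_interval_end k : (k < size (ends M))%N ->
  work M (nth 0 (ends M) k) = work M (nth 0 (0 :: ends M) k) +
    nth 0 (ratios M) k * (nth 0 (ends M) k - nth 0 (0 :: ends M) k).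
Proof.
move=> ks; apply: work_piece => //; first exact: ltnW.
exact/ltW/ends_lt.
Qed.

(** Work grows linearly within an interval, so a division gives the time at which it reaches [A];
    the program evaluates this formula. *)
Lemma work_solve k A : (k <= size (ends M))%N ->
  let b := nth 0 (0 :: ends M) k in let e := nth 0 (ratios M) k in
  work M b <= A ->
  ((k < size (ends M))%N -> A <= work M b + e * (nth 0 (ends M) k - b)) ->
  0 <= b + (A - work M b) / e /\ work M (b + (A - work M b) / e) = A.
Proof.
move=> ks b e bA Ae.
have e0 : 0 < e.
  have [sz _ /(_ e) + _] := vM; rewrite /e mem_nth; last by rewrite sz ltnS.
  by case/(_ isT)/andP.
have x0 : 0 <= (A - work M b) / e by rewrite divr_ge0 ?subr_ge0// ltW.
split; first by rewrite addr_ge0 ?ends_ge0.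
rewrite (work_piece vM ks) -/b -/e.
- by rewrite addrAC subrr add0r mulrC divfK ?gt_eqF// addrC subrK.
- by rewrite lerDl.
- by move=> /Ae h; rewrite addrC -lerBrDr ler_pdivrMr// lerBlDl mulrC.
Qed.

Lemma finish_spec L : 0 <= L -> 0 <= finish L /\ work M (finish L) = L.
Proof.
move=> L0; suff [x x0 <-] : exists2 x, 0 <= x & work M x = L by rewrite finishE.
(* The last interval whose left end is reached with at most [L] work contains the solution. *)
pose reached k := (k <= size (ends M))%N && (work M (nth 0 (0 :: ends M) k) <= L).
have r0 : exists k, reached k by exists 0%N; rewrite /reached /= work0.
have rb k : reached k -> (k <= size (ends M))%N by case/andP.
case: (ex_maxnP r0 rb) => k /andP[ks kL] kmax.
have [|x0 wx] := work_solve ks kL; last by eexists; [exact: x0|exact: wx].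
move=> ks'; rewrite -work_interval_end//; case: leP => // /ltW h.
by have := kmax k.+1; rewrite /reached ks' h ltnn => /(_ isT).
Qed.

End Interval.

(** * Correctness of the scheduling loops *)

Section Scheduling.
Variables (R : realType) (m : nat) (I : instance R m).
Hypothesis vI : forall i, valid_machine (mach I i).
Hypothesis p_ge0 : forall i, 0 <= job_size I i.
Variable a : nat -> nat.
Implicit Types (s : state R) (i : 'I_m).

Local Notation n := (njobs I).

Definition mload i j := psum (job_size I) a i j.

(** No idle time: job [j] starts when the earlier jobs of machine [i] are done. Both instants are
    characterised by the work available up to them. *)
Definition placed s i j :=
  [/\ iarr s 0 j = i, 0 <= rarr s 1 j, 0 <= rarr s 2 j,
      work (mach I i) (rarr s 1 j) = mload i j
    & work (mach I i) (rarr s 2 j) = mload i j.+1].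

Definition reads s := forall j, (j < n)%N -> iarr s 3 (iarr s 2 j) = a j.

Definition all_placed (D : pred 'I_m) s :=
  forall i j, (j < n)%N -> a j = i -> D i -> placed s i j.

(** Protects what the search keeps between two schedules: the bundles, the assignments and the best
    makespan. *)
Definition frame s s' :=
  (forall k, iarr s' k.+2 = iarr s k.+2) /\ rreg s' 6 = rreg s 6.

Lemma mload0 i : mload i 0 = 0.
Proof. exact: psum0. Qed.

Lemma mloadS i j : mload i j.+1 = mload i j + (if a j == i then job_size I j else 0).
Proof. exact: psumS. Qed.

Lemma mload_mono i j k : (j <= k)%N -> mload i j <= mload i k.
Proof. exact: psum_mono. Qed.

Lemma machine_halts X (D : pred 'I_m) i s :
  (n + size (ratios (mach I i)) < X)%N ->
  keeps_input I s -> reads s -> all_placed D s ->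
  halts X (machine_prog i) s (fun s' =>
    [/\ keeps_input I s', frame s s', all_placed (predU D (pred1 i)) s'
      & rreg s' 5 = Num.max (rreg s 5) (finish (mach I i) (mload i n))]).
Proof.
move=> nX ks rs pl; have X0 : (0 < X)%N by exact: leq_trans nX.
apply/halts_seq/halts_run => //; apply: halts_seq.
pose M := mach I i; have vM : valid_machine M by exact: vI.
have [szM _ _ _] := vM.
(* The bound on register 2 has [.+1] because a job may span several intervals: the current interval
   may begin after the current job starts, but not after it ends. *)
pose Inv s' :=
  [/\ keeps_input I s', frame s s', rreg s' 5 = rreg s 5, (iarr s' 1 0 <= n)%N &
   [/\ (iarr s' 1 1 < size (ratios M))%N,
       rreg s' 3 = nth 0 (0 :: ends M) (iarr s' 1 1),
       rreg s' 2 = work M (rreg s' 3), rreg s' 2 <= mload i (iarr s' 1 0).+1 &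
    [/\ 0 <= rreg s' 4, rreg s' 1 = mload i (iarr s' 1 0),
       work M (rreg s' 4) = rreg s' 1 &
       forall i' j, (j < n)%N -> a j = i' ->
         D i' || (i' == i) && (j < iarr s' 1 0)%N -> placed s' i' j]]].
pose mu s' := ((n - iarr s' 1 0) + (size (ratios M) - iarr s' 1 1))%N.
(* An iteration moves either to the next job or to the next interval. *)
apply: (@halts_while _ Inv mu) => //.
- by rewrite (leq_ltn_trans _ nX)// leq_add// leq_subr.
- split=> //=; rewrite /upd /= !rmorph0; split=> //; rewrite ?szM ?work0//.
    by rewrite -(mload0 i) mload_mono.
  split; rewrite ?mload0// ?work0// => i' j jn aj; rewrite ltn0 andbF orbF => Di.
  by case: (pl i' j jn aj Di) => *; split.
- move=> {ks pl}s' [[k1 k2 k3] [fi fr] s5 le [kM s3 s2 s2le [s40 s1 w4 pl]]].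
  rewrite /= k1 /= -ltnNge => lt.
  have asgE : iarr s' 3 (iarr s' 2 (iarr s' 1 0)) = a (iarr s' 1 0).
    by rewrite !fi rs.
  rewrite /= asgE -eqn_leq valK k2 !k3 input_ends input_ratios -/M -/(job_size I).
  set j := iarr s' 1 0 in le s2le s1 pl lt asgE *.
  set k := iarr s' 1 1 in kM s3 *.
  have kE : (k <= size (ends M))%N by rewrite -ltnS -szM.
  have [aj|naj] := boolP (a j == i); last first.
    split; last by rewrite /mu /= /upd /= -/j -/k; lia.
    split=> //=; rewrite /upd /= -?/j -?/k addn1//; split=> //.
      by rewrite (le_trans s2le)// mload_mono.
    split=> //; first by rewrite mloadS (negbTE naj) addr0.
    move=> i' j' jn aj' h; apply: pl => //.
    case/orP: h => [->//|/andP[/eqP ii]]; rewrite ltnS leq_eqVlt => /predU1P[jj|->].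
      by move: naj; rewrite -jj aj' ii eqxx.
    by rewrite ii eqxx orbT.
  have next : mload i j.+1 = rreg s' 1 + job_size I j by rewrite mloadS aj s1.
  (* The interval is left if it is not the last and its end comes before the job can be completed;
     on equality the job ends in it. *)
  have [adv|stay] := boolP (~~ (size (ratios M) <= k + 1)%N && _).
    case/andP: adv; rewrite -ltnNge -ltNge addn1 szM ltnS => kE' late.
    split; last by rewrite /mu /= /upd /= -/j -/k szM; lia.
    split=> //=; rewrite /upd /= -?/j -?/k ?addn1//; split=> //.
    - by rewrite szM ltnS.
    - by rewrite work_interval_end// s2 s3.
    - by rewrite next ltW.
  have [] := @work_solve _ M vM k (mload i j.+1) kE.
  - by rewrite -s3 -s2.
  - move=> kE'; move: stay; rewrite negb_and !negbK addn1 szM ltnS leqNgt kE' /=.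
    by rewrite next s2 s3.
  rewrite next -s3 -s2 => x0 wx.
  split; last by rewrite /mu /= /upd /= -/j -/k addn1; lia.
  split=> //=; rewrite /upd /= -?/j -?/k ?addn1 ?k2 ?k3 ?input_ratios -?/M -?/(job_size I)//.
  split=> //; first by rewrite (le_trans s2le)// mload_mono.
  split=> //.
  move=> i' j' jn aj' h; rewrite /placed /= /upd /= -?/j -?/k.
  have [jj|jj] := eqVneq j' j.
    have ii : i' = i by apply/val_inj; rewrite /= -aj' jj (eqP aj).
    by rewrite ii jj next -/M; split=> //; rewrite w4.
  apply: pl => //; case/orP: h => [->//|/andP[->]].
  by rewrite ltnS leq_eqVlt (negbTE jj) /= => ->; rewrite orbT.
- move=> {ks pl}s' [ks [fi fr] s5 le [kM s3 s2 s2le [s40 s1 w4 pl]]].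
  rewrite negbK /=; have [-> _ _] := ks => /= ge.
  have jn : iarr s' 1 0 = n by lia.
  have fin : finish M (mload i n) = rreg s' 4 by rewrite -jn -s1 -w4 finishE.
  have pl' : all_placed (predU D (pred1 i)) s'.
    by move=> i' j jn' aj /= h; apply: pl; rewrite // jn jn' andbT.
  apply: halts_run => //=; rewrite -/M fin -s5.
  have [h|h] := leP (rreg s' 4) (rreg s' 5); first by split.
  by split.
Qed.

Lemma machines_halts X (D : pred 'I_m) (l : seq 'I_m) s : (0 < X)%N ->
  (forall i, (n + size (ratios (mach I i)) < X)%N) ->
  keeps_input I s -> reads s -> all_placed D s ->
  halts X (machines_prog (map val l)) s (fun s' =>
    [/\ keeps_input I s', frame s s',
      all_placed (fun i => D i || (i \in l)) s'
      & rreg s' 5 =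
          foldl (fun M i => Num.max M (finish (mach I i) (mload i n))) (rreg s 5) l]).
Proof.
move=> X0 HX; elim: l D s => [|i l ih] D s ks rs pl.
  apply: halts_run => //; split=> // i j jn aj; rewrite orbF; exact: pl.
apply: halts_seq; apply: halts_conseq (machine_halts (HX i) ks rs pl) _.
move=> s1 [ks1 [f1 f1'] pl1 M1]; apply: halts_conseq (ih _ _ ks1 _ pl1) _.
  by move=> j jn; rewrite !f1 rs.
move=> s2 [ks2 [f2 f2'] pl2 M2]; split=> //.
- by split=> [k|]; rewrite ?f2 ?f2' ?f1 ?f1'.
- by move=> i' j jn aj; rewrite inE orbA => h; exact: pl2.
- by rewrite M2 M1.
Qed.

(** The makespan of the assignment [a] run without idle time, as the same left fold that the program
    computes in register 5. *)
Definition value : R :=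
  foldl (fun M i => Num.max M (finish (mach I i) (mload i n))) 0 (enum 'I_m).

Lemma schedule_halts X s : (0 < X)%N ->
  (forall i, (n + size (ratios (mach I i)) < X)%N) ->
  keeps_input I s -> reads s ->
  halts X (schedule_prog m) s (fun s' =>
    [/\ keeps_input I s', frame s s', all_placed predT s' & rreg s' 5 = value]).
Proof.
move=> X0 HX ks rs; apply/halts_seq/halts_run => //.
have pl : all_placed pred0 (run (CRSet 5 (RConst 0)) s) by [].
apply: halts_conseq (machines_halts (enum 'I_m) X0 HX _ _ pl) _ => //.
move=> s' [ks' fr pl' M']; split=> //.
- by move=> i j jn aj _; apply: pl'; rewrite ?mem_enum.
- by rewrite M' /= /upd /= rmorph0.
Qed.

Lemma le_foldl_max (T : Type) (g : T -> R) x (l : seq T) :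
  x <= foldl (fun M k => Num.max M (g k)) x l.
Proof. by elim: l x => //= k l ih x; apply: le_trans (ih _); rewrite le_max lexx. Qed.

Lemma value_ge0 : 0 <= value.
Proof. exact: le_foldl_max. Qed.

Lemma finish_le_value i : finish (mach I i) (mload i n) <= value.
Proof.
have : i \in enum 'I_m by rewrite mem_enum.
rewrite /value; elim: (enum 'I_m) 0 => //= k l ih x; rewrite inE => /predU1P[->|/ih//].
by apply: le_trans (le_foldl_max _ _ _); rewrite le_max lexx orbT.
Qed.

Lemma value_le C : 0 <= C -> (forall i, finish (mach I i) (mload i n) <= C) ->
  value <= C.
Proof.
move=> C0 H; rewrite /value; elim: (enum 'I_m) 0 C0 => //= k l ih x xC.
by apply: ih; rewrite ge_max xC H.
Qed.

End Scheduling.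

(** * Exhaustive search over the assignments of bundles *)

Definition write_prog (arr : nat) (e : nat -> iexp) (l : seq nat) :=
  foldr (fun v c => CSeq (CIPut arr (IConst v) (e v)) c) CSkip l.

Lemma straight_write arr e l : straight (write_prog arr e l).
Proof. by elim: l. Qed.

Section Search.
Variables (m N : nat).

Local Notation code := {ffun 'I_N.+1 -> 'I_m}.
Implicit Types F : code.

Definition code_at F (v : nat) : nat := F (inord v).

Definition assign_prog (e : nat -> iexp) :=
  CSeq (write_prog 3 e (iota 0 N.+1)) (schedule_prog m).

Definition save_prog F :=
  CSeq (CRSet 6 (RReg 5)) (write_prog 4 (IConst \o code_at F) (iota 0 N.+1)).

Definition try_prog F :=
  CSeq (assign_prog (IConst \o code_at F))
    (CIf (BLeR (RReg 5) (RReg 6)) (save_prog F) CSkip).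

(** Iterations over bundles and assignments are unrolled in the program text, their numbers being
    constants. [F0] gives the best makespan an initial value; the best assignment is scheduled again
    at the end because the output arrays hold the last one tried. *)
Definition ptas_prog F0 (Fs : seq code) :=
  CSeq sum_prog (CSeq (bundle_prog N)
    (CSeq (CSeq (assign_prog (IConst \o code_at F0)) (save_prog F0))
       (CSeq (foldr CSeq CSkip (map try_prog Fs))
          (assign_prog (fun v => IGet 4 (IConst v)))))).

Variables (R : realType) (I : instance R m) (X : nat).
Hypothesis vI : forall i, valid_machine (mach I i).
Hypothesis p_ge0 : forall i, 0 <= job_size I i.
Hypothesis X_gtn : (njobs I < X)%N.
Hypothesis X_ge : forall i, (njobs I + size (ratios (mach I i)) < X)%N.
Implicit Types s : state R.

Local Notation n := (njobs I).

Let X_gt0 : (0 < X)%N. Proof. exact: leq_trans X_gtn. Qed.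

(** Quantifying over the contents [h] of the overwritten array ensures that earlier writes do not
    affect the values still to be written. *)
Lemma run_write arr e (w : nat -> nat) l s :
  (forall h v, ieval (State (ireg s) (rreg s) (upd (iarr s) arr h) (rarr s)) (e v) = w v) ->
  exists h, run (write_prog arr e l) s
      = State (ireg s) (rreg s) (upd (iarr s) arr h) (rarr s) /\
    forall v, v \in l -> h v = w v.
Proof.
move=> H; suff G h0 : exists h,
    [/\ run (write_prog arr e l) (State (ireg s) (rreg s) (upd (iarr s) arr h0) (rarr s))
        = State (ireg s) (rreg s) (upd (iarr s) arr h) (rarr s),
      forall v, v \in l -> h v = w v & forall v, v \notin l -> h v = h0 v].
  have [h [E hw _]] := G (iarr s arr); exists h; split=> //.
  rewrite -E; congr run; case: (s) => f g k q /=; congr State.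
  by apply/funext => y; rewrite /upd; case: eqP => [->|].
elim: l h0 => [|x l ih] h0; first by exists h0.
have [h [E hw hn]] := ih (upd h0 x (w x)).
exists h; split=> [|v|v].
- rewrite -E /= -/(write_prog _ _ _); congr run.
  rewrite H /set_iarr /=; congr State; apply/funext => y.
  by rewrite upd_eq /upd; case: eqP.
- rewrite inE => /predU1P[->|/hw//].
  by have [/hw//|/hn ->] := boolP (x \in l); rewrite upd_eq.
- by rewrite inE negb_or => /andP[vx /hn ->]; rewrite upd_ne.
Qed.

Definition bounded s := forall j, (j < n)%N -> (iarr s 2 j < N.+1)%N.

Definition wvalue s (w : nat -> nat) := value I (fun j => w (iarr s 2 j)).

Lemma eq_wvalue s s' w w' : iarr s 2 = iarr s' 2 -> bounded s ->
  (forall v, (v < N.+1)%N -> w v = w' v) -> wvalue s w = wvalue s' w'.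
Proof.
move=> E bs H; rewrite /wvalue -E /value.
elim: (enum 'I_m) 0 => //= i l ih x; rewrite -ih; congr (foldl _ (Num.max _ (finish _ _)) _).
by apply: eq_psum => j /bs/H.
Qed.

Lemma assign_halts e w s : keeps_input I s -> bounded s ->
  (forall h v, ieval (State (ireg s) (rreg s) (upd (iarr s) 3 h) (rarr s)) (e v) = w v) ->
  halts X (assign_prog e) s (fun s' =>
    [/\ keeps_input I s', iarr s' 2 = iarr s 2, iarr s' 4 = iarr s 4 /\ rreg s' 6 = rreg s 6,
      all_placed I (fun j => w (iarr s 2 j)) predT s' & rreg s' 5 = wvalue s w]).
Proof.
move=> ks bs He; apply/halts_seq/halts_run => //; first exact: straight_write.
have [h [-> hw]] := run_write (iota 0 N.+1) He.
apply: halts_conseq (schedule_halts (a := fun j => w (iarr s 2 j)) vI p_ge0 X_gt0 X_ge _ _) _.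
- by case: ks.
- by move=> j jn; rewrite /upd /= hw// mem_iota /= add0n bs.
- by move=> s' [ks' [f1 f2] pl V]; split=> //; rewrite ?f1.
Qed.

Definition holds s F :=
  (forall v, (v < N.+1)%N -> iarr s 4 v = code_at F v) /\ rreg s 6 = wvalue s (code_at F).

Lemma save_run F s : keeps_input I s -> rreg s 5 = wvalue s (code_at F) ->
  let s' := run (save_prog F) s in
  [/\ keeps_input I s', iarr s' 2 = iarr s 2, rreg s' 6 = rreg s 5 & holds s' F].
Proof.
move=> ks V.
have -> : run (save_prog F) s =
    run (write_prog 4 (IConst \o code_at F) (iota 0 N.+1)) (set_rreg s 6 (rreg s 5)) by [].
have [|h [-> hw]] := @run_write 4 (IConst \o code_at F) (code_at F) (iota 0 N.+1)
   (set_rreg s 6 (rreg s 5)); first by [].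
split=> //; split=> [v vN|]; last by rewrite /= /upd /= V.
by rewrite /= /upd /= hw// mem_iota.
Qed.

Lemma init_halts F s : keeps_input I s -> bounded s ->
  halts X (CSeq (assign_prog (IConst \o code_at F)) (save_prog F)) s (fun s' =>
    [/\ keeps_input I s', iarr s' 2 = iarr s 2 & holds s' F]).
Proof.
move=> ks bs; apply/halts_seq.
apply: halts_conseq (@assign_halts _ (code_at F) s ks bs _) _ => //.
move=> s1 [ks1 b1 [a1 r1] _ V1]; apply: halts_run => //; first exact: straight_write.
have [|ks' b' r' h'] := @save_run F s1 ks1; first by rewrite V1; exact: eq_wvalue.
by split=> //; rewrite b'.
Qed.

Lemma try_halts F0 F s : keeps_input I s -> bounded s -> holds s F0 ->
  halts X (try_prog F) s (fun s' =>
    [/\ keeps_input I s', iarr s' 2 = iarr s 2, exists F', holds s' F',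
      rreg s' 6 <= rreg s 6 & rreg s' 6 <= wvalue s (code_at F)]).
Proof.
move=> ks bs [h1 h2]; apply/halts_seq.
apply: halts_conseq (@assign_halts _ (code_at F) s ks bs _) _ => //.
move=> s1 [ks1 b1 [a1 r1] _ V1]; apply: halts_run => //.
  by rewrite /= straight_write.
have [|ks' b' r' h'] := @save_run F s1 ks1; first by rewrite V1; exact: eq_wvalue.
rewrite [run _ _]/= -/(run (save_prog F) s1).
have [le|gt] := boolP (rreg s1 5 <= rreg s1 6).
  split=> //; first by rewrite b'.
  - by exists F.
  - by rewrite r' -r1.
  - by rewrite r' V1.
split=> //; rewrite ?r1//.
- exists F0; split=> [v vN|]; first by rewrite a1 h1.
  by rewrite r1 h2; exact: eq_wvalue.
- by rewrite -V1 -r1 ltW// ltNge.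
Qed.

(** Register 6 never increases, so the bound obtained for one assignment survives the later
    trials. *)
Lemma search_halts Fs F0 s : keeps_input I s -> bounded s -> holds s F0 ->
  halts X (foldr CSeq CSkip (map try_prog Fs)) s (fun s' =>
    [/\ keeps_input I s', iarr s' 2 = iarr s 2, exists F', holds s' F',
      rreg s' 6 <= rreg s 6 &
      forall F, F \in Fs -> rreg s' 6 <= wvalue s (code_at F)]).
Proof.
elim: Fs F0 s => [|F Fs ih] F0 s ks bs h0.
  by apply: halts_run => //; split=> //; exists F0.
apply/halts_seq; apply: halts_conseq (try_halts F ks bs h0) _.
move=> s1 [ks1 b1 [F1 h1] l1 l1']; apply: halts_conseq (ih F1 s1 ks1 _ h1) _.
  by rewrite /bounded b1.
move=> s2 [ks2 b2 [F2 h2] l2 l2']; split=> //; first by rewrite b2.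
- by exists F2.
- exact: le_trans l1.
- move=> F'; rewrite inE => /predU1P[->|/l2' h]; first exact: le_trans l1'.
  rewrite (le_trans h)// le_eqVlt (@eq_wvalue s1 s _ (code_at F'))// ?eqxx//.
  by rewrite /bounded b1.
Qed.

Lemma ptas_halts F0 Fs : 0 < \sum_(i < n) job_size I i ->
  halts X (ptas_prog F0 Fs) (input I) (fun s =>
    exists b, [/\ forall j, (j < n)%N -> (b j < N.+1)%N,
      forall v, N%:R * psum (job_size I) b v n <= 2 * \sum_(i < n) job_size I i \/
        forall i i', (i < n)%N -> (i' < n)%N -> b i = v -> b i' = v -> i = i' &
      exists a F, [/\ forall j, (j < n)%N -> a j = code_at F (b j),
        all_placed I a predT s &
        forall F', F' \in Fs -> value I a <= value I (fun j => code_at F' (b j))]]).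
Proof.
move=> P0; have ks : keeps_input I (input I) by [].
apply: halts_seq; apply: halts_conseq (sum_halts X_gtn ks) _ => s1 [ks1 P1].
apply: halts_seq; apply: halts_conseq (bundle_halts N p_ge0 erefl P0 X_gtn ks1 P1) _.
move=> s2 [ks2 bs sh]; apply: halts_seq; apply: halts_conseq (init_halts F0 ks2 bs) _.
move=> s3 [ks3 b3 h3].
have bs3 : bounded s3 by rewrite /bounded b3.
apply: halts_seq; apply: halts_conseq (search_halts Fs ks3 bs3 h3) _.
move=> s4 [ks4 b4 [F [hF1 hF2]] _ l4].
have bs4 : bounded s4 by rewrite /bounded b4.
apply: halts_conseq (@assign_halts _ (iarr s4 4) s4 ks4 bs4 _) _ => //.
move=> s5 [ks5 b5 _ pl _]; exists (iarr s2 2); split=> //.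
have E : iarr s4 2 = iarr s2 2 by rewrite b4.
exists (fun j => iarr s4 4 (iarr s4 2 j)), F; split=> [j jn|//|F' F'in].
  by rewrite E hF1// bs.
have := l4 _ F'in; rewrite hF2 /wvalue b3 => h; apply: le_trans h.
by rewrite le_eqVlt -[eqbLHS]/(wvalue s4 _) (@eq_wvalue s4 s4 _ (code_at F))// eqxx.
Qed.

End Search.

(** * Approximation ratio *)

Section Approximation.
Variables (R : realType) (m m1 : nat) (e0 : R) (I : instance R m).
Hypothesis I_valid : valid_instance m1 e0 I.

Local Notation n := (njobs I).

Lemma mach_valid i : valid_machine (mach I i).
Proof. by case: I_valid. Qed.

Lemma job_size_ge0 i : 0 <= job_size I i.
Proof.
case: I_valid => _ H _ _; rewrite /job_size /=.
by case: insubP => // j _ _; exact: ltW.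
Qed.

Lemma mload_ord a i : mload I a i n = \sum_(j < n | a j == i) ptime I j.
Proof. by apply: eq_bigr => j _; rewrite job_sizeE. Qed.

Lemma mload_ge0 a i j : 0 <= mload I a i j.
Proof. by apply: sumr_ge0 => k _; exact: job_size_ge0. Qed.

Section Output.
Variables (a : nat -> nat) (s : state R) (S : schedule R m n).
Hypothesis s_placed : all_placed I a predT s.
Hypothesis S_out : outputs s S.
Hypothesis S_a : forall j : 'I_n, a j = assigned S j.

Lemma placed_job (j : 'I_n) : let M := mach I (assigned S j) in
  [/\ 0 <= start S j, 0 <= completion S j,
      work M (start S j) = mload I a (assigned S j) j
    & work M (completion S j) = mload I a (assigned S j) j.+1].
Proof.
have [_ s1 s2] := S_out j.
by have [_] := s_placed (ltn_ord j) (S_a j) isT; rewrite s1 s2.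
Qed.

(** Start and completion correspond to consecutive partial loads, so jobs of one machine run in
    index order; strict monotonicity of work turns this into inequalities between times. *)
Lemma output_feasible : feasible I S.
Proof.
have sc j : start S j <= completion S j.
  have [s0 c0 ws wc] := placed_job j.
  rewrite -(work_mono (mach_valid (assigned S j)))// ws wc mload_mono//.
  exact: job_size_ge0.
have sep (j k : 'I_n) : (j < k)%N -> assigned S j = assigned S k ->
    completion S j <= start S k.
  move=> jk E; have [_ c0 _ wc] := placed_job j; have [s0 _ ws _] := placed_job k.
  rewrite -(work_mono (mach_valid (assigned S k)))// -{1}E wc ws E.
  by apply: mload_mono => //; exact: job_size_ge0.
split; [|split].
- by move=> j; rewrite sc; have [->] := placed_job j.
- move=> j; have [s0 c0 ws wc] := placed_job j.
  rewrite integral_work//; last exact: mach_valid.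
  by rewrite ws wc mloadS S_a eqxx addrC addKr job_sizeE.
- move=> j k jk E; case: (ltngtP j k) => [h|h|/val_inj h].
  + by left; exact: sep.
  + by right; exact: sep.
  + by rewrite h eqxx in jk.
Qed.

Lemma output_makespan : makespan S <= value I a.
Proof.
apply: bigmax_le => [|j _]; first exact: value_ge0.
apply: le_trans (finish_le_value _ _ (assigned S j)).
have [f0 fE] := finish_spec (mach_valid (assigned S j)) (mload_ge0 a (assigned S j) n).
have [_ c0 _ wc] := placed_job j.
rewrite -(work_mono (mach_valid (assigned S j)))// fE wc mload_mono//.
exact: job_size_ge0.
Qed.

End Output.

Lemma makespan_ge0 (S : schedule R m n) : 0 <= makespan S.
Proof. exact: bigmax_ge_id. Qed.

Lemma feasible_load (S : schedule R m n) i : feasible I S ->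
  \sum_(j | assigned S j == i) ptime I j <= work (mach I i) (makespan S).
Proof.
case=> sc [int sep].
apply: (disjoint_work (s := start S) (c := completion S)).
- exact: mach_valid.
- by move=> j _; apply/andP.
- by move=> j _; exact: le_bigmax.
- exact: makespan_ge0.
- by move=> j /eqP <-.
- by move=> j k /eqP Ej /eqP Ek jk; apply: sep; rewrite ?Ej.
Qed.

(** Rates are at most 1, so each of the [m] machines processes at most [makespan S] units of
    work. *)
Lemma feasible_total (S : schedule R m n) : feasible I S ->
  \sum_(i < n) job_size I i <= m%:R * makespan S.
Proof.
move=> fS; have C0 := makespan_ge0 S.
rewrite (eq_bigr (fun j => ptime I j)); last by move=> j _; rewrite job_sizeE.
rewrite (partition_big (assigned S) xpredT)//=.
have -> : m%:R * makespan S = \sum_(i < m) makespan S by rewrite sumr_const card_ord mulr_natl.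
apply: ler_sum => i _; apply: le_trans (feasible_load i fS) _.
by have := work_le (mach_valid i) (lexx 0) C0; rewrite work0 !subr0.
Qed.

Lemma bundled_value (N : nat) (eps : R) (b : nat -> nat) (i0 : 'I_m) (S : schedule R m n) :
  0 < e0 -> (i0 < m1)%N -> (0 < N)%N -> m%:R ^+ 2 * 2 / (e0 * eps) <= N%:R -> 0 < eps ->
  (forall j, (j < n)%N -> (b j < N.+1)%N) ->
  (forall v, N%:R * psum (job_size I) b v n <= 2 * \sum_(i < n) job_size I i \/
     forall i i', (i < n)%N -> (i' < n)%N -> b i = v -> b i' = v -> i = i') ->
  feasible I S ->
  exists F : {ffun 'I_N.+1 -> 'I_m},
    value I (fun j => code_at F (b j)) <= (1 + eps) * makespan S.
Proof.
move=> e0_gt0 i0m N0 hN eps0 bN sh fS.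
set P := \sum_(i < n) _ in sh *; set C := makespan S.
have C0 : 0 <= C := makespan_ge0 S.
have P0 : 0 <= P by apply: sumr_ge0 => i _; exact: job_size_ge0.
have PC : P <= m%:R * C := feasible_total fS.
have NR0 : 0 < N%:R :> R by rewrite ltr0n.
pose eta := 2 * P / N%:R.
have eta0 : 0 <= eta by rewrite divr_ge0 ?mulr_ge0.
pose b' (j : 'I_n) : 'I_N.+1 := inord (b j).
have b'E (j : 'I_n) : val (b' j) = b j by rewrite /= inordK// bN.
have [j||F [F1 F2]] :=
  @bundle_rounding _ _ n m (fun j => ptime I j) b' (assigned S) i0 eta _ eta0.
- by rewrite -job_sizeE job_size_ge0.
- move=> v; have [h|h] := sh (val v).
    left; rewrite ler_pdivlMr// mulrC; apply: le_trans h; rewrite le_eqVlt; apply/orP; left.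
    apply/eqP; congr (_ * _); rewrite /psum [RHS](eq_bigr (fun j => ptime I j)); last first.
      by move=> j _; rewrite job_sizeE.
    by apply: eq_bigl => j; rewrite -b'E.
  right=> j j' /(congr1 val) + /(congr1 val); rewrite !b'E => h1 h2.
  exact/val_inj/(h _ _ _ _ h1 h2).
have Fload i : mload I (fun j => code_at F (b j)) i n = \sum_(j | F (b' j) == i) ptime I j.
  by rewrite mload_ord.
(* The time to process the excess [m * eta] at rate [e0]; it is bounded by [P <= m * C] and the
   choice of [N]. *)
have extra : m%:R * eta / e0 <= eps * C.
  rewrite ler_pdivrMr// /eta mulrA ler_pdivrMr//.
  move: hN; rewrite ler_pdivrMr ?mulr_gt0// => hN.
  have := ler_wpM2r C0 hN; have : m%:R * (2 * P) <= m%:R * (2 * (m%:R * C)).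
    by rewrite ler_wpM2l// ler_wpM2l.
  lra.
have extra0 : 0 <= m%:R * eta / e0 by rewrite divr_ge0 ?mulr_ge0// ltW.
exists F; apply: value_le => [|i]; first by rewrite mulr_ge0// addr_ge0// ltW.
have [f0 fE] := finish_spec (mach_valid i) (mload_ge0 (fun j => code_at F (b j)) i n).
suff h : finish (mach I i) (mload I (fun j => code_at F (b j)) i n) <= C + m%:R * eta / e0.
  by rewrite (le_trans h)// mulrDl mul1r lerD2l.
(* Instead of the times, the amounts of work available up to them are compared. *)
rewrite -(work_mono (mach_valid i)) ?addr_ge0// fE Fload.
have wC : work (mach I i) C <= work (mach I i) (C + m%:R * eta / e0).
  by rewrite work_mono ?addr_ge0 ?lerDl//; exact: mach_valid.
have [->|ii0] := eqVneq i i0; last first.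
  by rewrite (le_trans (F1 _ ii0))// (le_trans (feasible_load i fS)).
rewrite (le_trans F2)//.
have ratios_ge : forall e, e \in ratios (mach I i0) -> e0 <= e.
  by case: I_valid => _ _ _; apply.
have CC : C <= C + m%:R * eta / e0 by rewrite lerDl.
(* At rate at least [e0], the added time provides at least the excess [m * eta]. *)
have := work_ge (mach_valid i0) C0 CC (ltW e0_gt0) ratios_ge.
rewrite [C + _]addrC addrK mulrC divfK ?gt_eqF// => h.
have := feasible_load i0 fS; rewrite -/C; lra.
Qed.

Lemma sum_intervals :
  (\sum_(i < m) size (ratios (mach I i)) <= (total_shared I).*2 + m)%N.
Proof.
apply: (@leq_trans (\sum_(i < m) (2 * nshared (mach I i) + 1))).
  by apply: leq_sum => i _; have [_ _ _] := mach_valid i; rewrite mul2n addn1.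
by rewrite big_split /= sum1_card card_ord -big_distrr /= mul2n.
Qed.

End Approximation.

Theorem theorem1 (R : realType) (m m1 : nat) (e0 eps : R)
    (hm1 : (1 <= m1 <= m - 1)%N) (he0 : 0 < e0 <= 1) (heps : 0 < eps < 1) :
  exists (prog : cmd) (c : nat),
    forall I : instance R m, valid_instance m1 e0 I ->
    exists (t : nat) (s : state R) (S : schedule R m (njobs I)),
      [/\ exec prog (input I) t s,
          outputs s S,
          feasible I S,
          makespan S <= (1 + eps) * opt_makespan I
        & (t <= c * (njobs I + total_shared I))%N].
Proof.
have [e0_gt0 _] := andP he0; have [eps0 _] := andP heps.
have [m1_gt0 m1m] := andP hm1.
have m_gt0 : (0 < m)%N by lia.
(* Since [0 < m1], the ratios of this machine are at least [e0]; it receives the overflow. *)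
pose i0 := Ordinal m_gt0.
pose x : R := m%:R ^+ 2 * 2 / (e0 * eps).
have x0 : 0 <= x by rewrite divr_ge0 ?mulr_ge0 ?exprn_ge0// ltW.
pose N := Num.bound x.
have xN : x < N%:R by exact: archi_boundP.
have N0 : (0 < N)%N by rewrite -(ltr0n R) (le_lt_trans x0).
pose F0 : {ffun 'I_N.+1 -> 'I_m} := [ffun=> i0].
pose prog := ptas_prog F0 (enum {: {ffun 'I_N.+1 -> 'I_m}}).
(* The loop bound is [n + (2 * total_shared I + m) + 1] at most, and [n >= 1] lets [m.+2] times the
   input size absorb the constant [m + 1]. *)
exists prog, (ccost prog * m.+2)%N => I vI.
have [n0 p0 _ _] := vI.
pose X := (njobs I + \sum_(i < m) size (ratios (mach I i))).+1.
have nX : (njobs I < X)%N by rewrite ltnS leq_addr.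
have sX i : (njobs I + size (ratios (mach I i)) < X)%N.
  by rewrite ltnS leq_add2l (bigD1 i)//= leq_addr.
have P0 : 0 < \sum_(i < njobs I) job_size I i.
  apply: (lt_le_trans (p0 (Ordinal n0))); rewrite -job_sizeE (bigD1 (Ordinal n0))//= lerDl.
  by apply: sumr_ge0 => i _; exact: job_size_ge0 vI _.
have [t [s [ex tX [b [bN sh [a [F [aF pl best]]]]]]]] :=
  ptas_halts (mach_valid vI) (job_size_ge0 vI) nX sX F0 (enum {: {ffun 'I_N.+1 -> 'I_m}}) P0.
pose S := Schedule (fun j : 'I_(njobs I) => F (inord (b j)))
  (fun j => rarr s 1 j) (fun j => rarr s 2 j).
have Sa (j : 'I_(njobs I)) : a j = assigned S j by rewrite aF.
have out : outputs s S.
  by move=> j; have [-> _ _ _ _] := pl _ _ (ltn_ord j) (Sa j) isT.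
have fS := output_feasible vI pl out Sa.
exists t, s, S; split=> //.
(* The optimum is an infimum, so it suffices that [makespan S / (1 + eps)] is a lower bound for the
   feasible makespans; [S] itself shows that there are some. *)
- rewrite mulrC -ler_pdivrMr ?addr_gt0//.
  apply: lb_le_inf; first by exists (makespan S), S.
  move=> _ [S' fS' <-]; rewrite ler_pdivrMr ?addr_gt0// mulrC.
  have [F' hF'] := bundled_value vI (i0 := i0) e0_gt0 m1_gt0 N0 (ltW xN) eps0 bN sh fS'.
  apply: le_trans hF'; apply: le_trans (best F' _); last by rewrite mem_enum.
  exact: output_makespan vI _ _ _ pl out Sa.
- rewrite (leq_trans tX)// -mulnA leq_mul2l; apply/orP; right.
  have := sum_intervals vI; rewrite /X; nia.
Qed.
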